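(* Let $E\subset\mathbb{R}^2$ be a boundary element with nodal basis vector $\boldsymbol{\phi}(\boldsymbol{x})\in\mathbb{R}^{N}$, let $\tilde{\boldsymbol{x}}$ be a point of the surrogate boundary on $E$ with unit normal $\tilde{\boldsymbol{n}}\in\mathbb{R}^2$ to the surrogate boundary, let $\bar{\boldsymbol{x}}$ be the corresponding point of the true boundary with unit normal $\boldsymbol{n}\in\mathbb{R}^2$ to the true boundary, let $\boldsymbol{u}\in\mathbb{R}^{N}$ be the coefficient vector of the internal polynomial $u_h(\boldsymbol{x})=\boldsymbol{\phi}^T(\boldsymbol{x})\boldsymbol{u}$, and let $q_N\in\mathbb{R}$ be the Neumann value prescribed at $\bar{\boldsymbol{x}}$. Let $(\boldsymbol{v},\lambda)\in\mathbb{R}^{N}\times\mathbb{R}$ be the solution, obtained by inversion, of the linear system $$\begin{bmatrix} I & \boldsymbol{n} \cdot \nabla \boldsymbol{\phi}(\bar{\boldsymbol{x}}) \\ (\boldsymbol{n} \cdot \nabla \boldsymbol{\phi}(\bar{\boldsymbol{x}}))^T & 0 \end{bmatrix} \begin{bmatrix}\boldsymbol{v} \\ \lambda \end{bmatrix} = \begin{bmatrix} \boldsymbol{u} \\ q_N \end{bmatrix},$$ let $\tilde u_N(\boldsymbol{x})=\boldsymbol{\phi}^T(\boldsymbol{x})\boldsymbol{v}$, and let $\tilde q_N:=\tilde{\boldsymbol{n}}\cdot\nabla\tilde u_N(\tilde{\boldsymbol{x}})$ be the ROD-E modified Neumann boundary condition at $\tilde{\boldsymbol{x}}$. Then $$\tilde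 q_N = [\tilde{\boldsymbol{n}} \cdot \nabla \boldsymbol{\phi}(\tilde{\boldsymbol{x}}) - \alpha\, \boldsymbol{n} \cdot \nabla \boldsymbol{\phi}(\bar{\boldsymbol{x}})]^T \boldsymbol{u} + \alpha\, q_N,\qquad \alpha = \frac{(\tilde{\boldsymbol{n}} \cdot \nabla \boldsymbol{\phi}(\tilde{\boldsymbol{x}}))^T (\boldsymbol{n} \cdot \nabla \boldsymbol{\phi}(\bar{\boldsymbol{x}}))}{\|\boldsymbol{n} \cdot \nabla \boldsymbol{\phi}(\bar{\boldsymbol{x}})\|_2^2}.$$
   Context: The boundary element $E$ is an affine image of the reference square $[-1,1]^2$. For a polynomial degree $p\ge 1$ and $N=(p+1)^2$, $\boldsymbol{\phi}=[\phi_1,\ldots,\phi_N]^T$ is the vector of nodal (Lagrange) basis polynomials on $E$, namely the tensor-product Lagrange polynomials of degree $p$ in each variable associated with the tensor-product Gauss-Lobatto-Legendre points. They form a basis of the local polynomial space. As polynomials they (and their gradients) are also evaluated at points outside $E$, so $\nabla\boldsymbol{\phi}(\bar{\boldsymbol{x}})$ makes sense even when $\bar{\boldsymbol{x}}\notin E$. For a vector $\boldsymbol{m}\in\mathbb{R}^2$ and a point $\boldsymbol{x}$, $\boldsymbol{m}\cdot\nabla\boldsymbol{\phi}(\boldsymbol{x})=[\boldsymbol{m}\cdot\nabla\phi_1(\boldsymbol{x}),\ldots,\boldsymbol{m}\cdot\nabla\phi_N(\boldsymbol{x})]^T$ is a column vector in $\mathbb{R}^N$. $I$ is the $N\times N$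 identity matrix and $\|\cdot\|_2$ is the Euclidean norm on $\mathbb{R}^N$. The surrogate boundary is the boundary of the unfitted computational mesh to which $E$ belongs; each of its points $\tilde{\boldsymbol{x}}$ is mapped to a point $\bar{\boldsymbol{x}}$ of the true boundary of the physical domain, where the boundary condition is prescribed. The linear system consists of the optimality conditions of the functional $\mathcal{L}(\boldsymbol{v},\lambda)=\frac12\|\boldsymbol{v}-\boldsymbol{u}\|_2^2+\lambda(\boldsymbol{n}\cdot\nabla\tilde u_N(\bar{\boldsymbol{x}})-q_N)$. *)

(* Defs.v *)
From HB Require Import structures.
From mathcomp Require Import all_boot all_order all_algebra.
From mathcomp Require Import all_classical all_reals all_analysis.

Set Implicit Arguments.
Unset Strict Implicit.
Unset Printing Implicit Defensive.

Import Order.TTheory GRing.Theory Num.Theory.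
Import numFieldNormedType.Exports.

Local Open Scope classical_set_scope.
Local Open Scope ring_scope.

Definition dotv (R : realType) (n : nat) (a b : 'cV[R]_n) : R :=
  (a^T *m b) 0 0.

(* The library norm on matrices is the max norm, hence this one. *)
Definition norm2 (R : realType) (n : nat) (a : 'cV[R]_n) : R :=
  Num.sqrt (\sum_(i < n) a i 0 ^+ 2).

Definition grad (R : realType) (f : 'cV[R]_2 -> R) (x : 'cV[R]_2) : 'cV[R]_2 :=
  \col_(i < 2) 'D_(delta_mx i 0 : 'cV[R]_2) f x.

(* Rodrigues' formula. *)
Definition legendre (R : realType) (p : nat) : {poly R} :=
  (2 ^+ p * p`!%:R)^-1 *: (('X ^+ 2 - 1) ^+ p)^`(p).

(* For p >= 1 the polynomial (1 - X^2) P_p' has degree p + 1, so these are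
   all its roots, listed increasingly: such a z exists and is unique. *)
Definition gll_nodes (R : realType) (p : nat) (z : 'I_p.+1 -> R) : Prop :=
  (forall i j : 'I_p.+1, (i < j)%N -> z i < z j) /\
  (forall i : 'I_p.+1, root ((1 - 'X ^+ 2) * (legendre R p)^`()) (z i)).

Definition lagrange_poly (R : realType) (n : nat) (z : 'I_n -> R) (i : 'I_n) :
    {poly R} :=
  \prod_(j < n | j != i) ((z i - z j)^-1 *: ('X - (z j)%:P)).

(* The element is the image of the reference square under r |-> A r + b. *)
Definition element (R : realType) (A : 'M[R]_2) (b : 'cV[R]_2) :
    set 'cV[R]_2 :=
  [set A *m r + b | r in [set r : 'cV[R]_2 | forall i, -1 <= r i 0 <= 1]].

Definition ref_coord (R : realType) (A : 'M[R]_2) (b x : 'cV[R]_2) :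
    'cV[R]_2 :=
  invmx A *m (x - b).

(* Nodal basis vector, evaluated at an arbitrary point of the plane; mxvec
   numbers the pairs of one-dimensional indices (i, j). *)
Definition nodal_basis (R : realType) (p : nat) (z : 'I_p.+1 -> R)
    (A : 'M[R]_2) (b x : 'cV[R]_2) : 'cV[R]_(p.+1 * p.+1) :=
  let r := ref_coord A b x in
  (mxvec (\matrix_(i < p.+1, j < p.+1)
     ((lagrange_poly z i).[r 0 0] * (lagrange_poly z j).[r 1 0])))^T.

Definition dir_grad (R : realType) (N : nat) (phi : 'cV[R]_2 -> 'cV[R]_N)
    (m x : 'cV[R]_2) : 'cV[R]_N :=
  \col_(k < N) dotv m (grad (fun y => phi y k 0) x).

Definition saddle_mx (R : realType) (N : nat) (w : 'cV[R]_N) : 'M[R]_(N + 1) :=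
  block_mx 1%:M w w^T 0.

Definition frontier (T : topologicalType) (S : set T) : set T :=
  closure S `\` interior S.

(* t belongs to the Bouligand tangent cone of S at x. *)
Definition tangent (R : realType) (S : set 'cV[R]_2) (x t : 'cV[R]_2) : Prop :=
  exists (h : nat -> R) (y : nat -> 'cV[R]_2),
    [/\ forall n, 0 < h n, h @ \oo --> (0 : R), forall n, S (y n) &
        (fun n => (h n)^-1 *: (y n - x)) @ \oo --> t].

(* On a smooth arc this leaves the two opposite unit normals; at a corner the
   normals of both incident arcs are admitted. *)
Definition unit_normal (R : realType) (S : set 'cV[R]_2) (x m : 'cV[R]_2) :
    Prop :=
  norm2 m = 1 /\
  exists t : 'cV[R]_2, [/\ t != 0, tangent S x t & dotv m t = 0].

(* Main.v *)
Require Import Defs.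
From HB Require Import structures.
From mathcomp Require Import all_boot all_order all_algebra.
From mathcomp Require Import all_classical all_reals all_analysis.
From mathcomp Require Import ring.

Set Implicit Arguments.
Unset Strict Implicit.
Unset Printing Implicit Defensive.

Import Order.TTheory GRing.Theory Num.Theory.
Import numFieldNormedType.Exports.

Local Open Scope classical_set_scope.
Local Open Scope ring_scope.

(** The saddle-point matrix has Schur complement [- |w|^2], where
    [w = n . grad phi (xb)]; when [w != 0] elimination gives
    [v = u - lam w] with [lam = (w . u - qN) / |w|^2].  Differentiation is
    linear in the coefficient vector, so that [qt = g . v] with
    [g = nt . grad phi (xt)] ([dir_grad_comb]), and substituting [v] gives the
    stated formula.

    The point that needs the finite element itself is [w != 0], for every
    direction [n != 0] and every point of the plane
    ([dir_grad_nodal_neq0]).  As [p >= 1], Lagrange interpolation reproduces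
    the constant 1 and the coordinate [X], hence the two reference coordinates
    are combinations of the nodal basis functions.  If [w] vanished, both would
    have a zero derivative along [n], that is [A^-1 n = 0], which forces
    [n = 0]; a unit normal is not zero. *)

(** * The Euclidean product *)

Lemma dotvE (R : realType) (n : nat) (a b : 'cV[R]_n) :
  dotv a b = \sum_i a i 0 * b i 0.
Proof. by rewrite /dotv mxE; apply: eq_bigr => i _; rewrite mxE. Qed.

Lemma dotvC (R : realType) (n : nat) (a b : 'cV[R]_n) : dotv a b = dotv b a.
Proof. by rewrite !dotvE; apply: eq_bigr => i _; rewrite mulrC. Qed.

Lemma dotvDl (R : realType) (n : nat) (a b c : 'cV[R]_n) :
  dotv (a + b) c = dotv a c + dotv b c.
Proof. by rewrite /dotv linearD mulmxDl !mxE. Qed.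

Lemma dotvZl (R : realType) (n : nat) (k : R) (a b : 'cV[R]_n) :
  dotv (k *: a) b = k * dotv a b.
Proof. by rewrite /dotv linearZ -scalemxAl mxE. Qed.

Lemma dotvBl (R : realType) (n : nat) (a b c : 'cV[R]_n) :
  dotv (a - b) c = dotv a c - dotv b c.
Proof. by rewrite dotvDl -scaleN1r dotvZl mulN1r. Qed.

Lemma norm2_sqr (R : realType) (n : nat) (a : 'cV[R]_n) :
  norm2 a ^+ 2 = dotv a a.
Proof.
rewrite /norm2 dotvE sqr_sqrtr; last by apply: sumr_ge0 => i _; exact: sqr_ge0.
by apply: eq_bigr => i _; rewrite expr2.
Qed.

Lemma norm2_eq0 (R : realType) (n : nat) (a : 'cV[R]_n) :
  norm2 a = 0 -> a = 0.
Proof.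
move=> /eqP; rewrite sqrtr_eq0 => le0.
have /eqP : \sum_i a i 0 ^+ 2 = 0.
  by apply/eqP; rewrite eq_le le0 sumr_ge0 // => i _; exact: sqr_ge0.
rewrite psumr_eq0 => [/allP a0|i _]; last exact: sqr_ge0.
apply/colP => i; rewrite mxE; apply/eqP; rewrite -sqrf_eq0.
by apply: a0; rewrite mem_index_enum.
Qed.

Lemma dotvv_eq0 (R : realType) (n : nat) (a : 'cV[R]_n) :
  dotv a a = 0 -> a = 0.
Proof.
by rewrite -norm2_sqr => /eqP; rewrite sqrf_eq0 => /eqP/norm2_eq0.
Qed.

(** * The saddle-point system *)

(** Block elimination: the factors below have determinants 1 and
    [- dotv w w]. *)
Lemma saddle_mx_unit (R : realType) (N : nat) (w : 'cV[R]_N) :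
  w != 0 -> saddle_mx w \in unitmx.
Proof.
move=> w0; have -> : saddle_mx w =
    block_mx 1%:M 0 w^T 1%:M *m block_mx 1%:M w 0 (- (w^T *m w)).
  by rewrite mulmx_block !mul1mx !mul0mx !mulmx1 !addr0 subrr.
rewrite unitmxE det_mulmx det_lblock det_ublock !det1 !mul1r det_mx11 mxE.
by rewrite unitfE oppr_eq0; apply: contraNneq w0 => /dotvv_eq0 ->.
Qed.

Lemma saddle_solution (R : realType) (N : nat) (w u v : 'cV[R]_N) (lam q : R) :
  w != 0 -> saddle_mx w *m col_mx v lam%:M = col_mx u q%:M ->
  v = u - ((dotv w u - q) / norm2 w ^+ 2) *: w.
Proof.
move=> w0; rewrite mul_block_col mul1mx mul0mx addr0 mul_mx_scalar.
move=> /eq_col_mx[<- wvq].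
have <- : dotv w v = q by rewrite /dotv wvq mxE eqxx mulr1n.
rewrite dotvC dotvDl dotvZl [dotv v w]dotvC [dotv w v + _]addrC addrK norm2_sqr.
rewrite mulfK ?addrK //.
by apply: contraNneq w0 => /dotvv_eq0 ->.
Qed.

(** The modified flux is such a functional of [v], with [g] the normal
    derivatives of the basis at the surrogate point; the formula is what
    eliminating [lam] leaves of it. *)
Lemma dotv_saddle_solution (R : realType) (N : nat) (g w u v : 'cV[R]_N)
    (lam q : R) :
  w != 0 -> saddle_mx w *m col_mx v lam%:M = col_mx u q%:M ->
  let alpha := dotv g w / norm2 w ^+ 2 in
  dotv g v = dotv (g - alpha *: w) u + alpha * q.
Proof.
move=> w0 /(saddle_solution w0) -> /=.
rewrite [LHS]dotvC !dotvBl !dotvZl [dotv u g]dotvC [dotv w g]dotvC.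
by ring.
Qed.

(** * Directional derivatives *)

Lemma grad_comb (R : realType) (N : nat) (phi : 'cV[R]_2 -> 'cV[R]_N)
    (x : 'cV[R]_2) (c : 'cV[R]_N) (l : 'I_2) :
  (forall k, derivable (fun y => phi y k 0) x (delta_mx l 0 : 'cV[R]_2)) ->
  grad (fun y => dotv (phi y) c) x l 0 =
  \sum_k grad (fun y => phi y k 0) x l 0 * c k 0.
Proof.
move=> dphi; rewrite mxE.
have -> : (fun y => dotv (phi y) c) =
    \sum_(k < N) (c k 0 \*: (fun y => phi y k 0)).
  apply/funext => y; rewrite dotvE fct_sumE.
  by apply: eq_bigr => k _; rewrite mulrC.
rewrite derive_sum => [|k]; last exact: derivableZ.
by apply: eq_bigr => k _; rewrite deriveZ // mxE mulrC.
Qed.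

(** Linearity of the gradient in the coefficients: this is what turns fluxes of
    finite element functions into Euclidean products. *)
Lemma dir_grad_comb (R : realType) (N : nat) (phi : 'cV[R]_2 -> 'cV[R]_N)
    (m x : 'cV[R]_2) (c : 'cV[R]_N) :
  (forall k l, derivable (fun y => phi y k 0) x (delta_mx l 0 : 'cV[R]_2)) ->
  dotv m (grad (fun y => dotv (phi y) c) x) = dotv (dir_grad phi m x) c.
Proof.
move=> dphi; rewrite !dotvE.
under eq_bigr => l _ do rewrite grad_comb // mulr_sumr.
rewrite exchange_big; apply: eq_bigr => k _ /=.
by rewrite mxE dotvE mulr_suml; apply: eq_bigr => l _; rewrite mulrA.
Qed.

(** A directional derivative only depends on the restriction to a line; this
    reduces the calculus for functions of the plane to that of polynomials. *)
Lemma is_derive_line (R : realType) (f : 'cV[R]_2 -> R) (x v : 'cV[R]_2)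
    (q : {poly R}) :
  (forall h, f (h *: v + x) = q.[h]) -> is_derive x v f q^`().[0].
Proof.
move=> fq.
have fE : (fun h : R => f (h *: v + x)) = horner q by apply/funext.
have df : derivable f x v by apply/derivable1P; rewrite fE; exact: derivable_horner.
split=> //.
have -> : 'D_v f x = 'D_1 (fun h : R => f (h *: v + x)) 0.
  (* the two difference quotients are the same function of h *)
  rewrite /derive; set F := (X in X @ _); set G := (X in _ = lim (X @ _)).
  suff -> : F = G by [].
  apply/funext => h; rewrite /F /G /=.
  by rewrite scale0r add0r addr0 /GRing.scale /= mulr1.
by rewrite fE derive_val.
Qed.

Lemma ref_coord_line (R : realType) (A : 'M[R]_2) (b x v : 'cV[R]_2) (h : R)
    (l : 'I_2) :
  ref_coord A b (h *: v + x) l 0 =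
  ((ref_coord A b x l 0)%:P + (invmx A *m v) l 0 *: 'X).[h].
Proof.
rewrite /ref_coord -addrA mulmxDr -scalemxAr !hornerE mxE [in LHS]mxE.
by rewrite addrC [h * _]mulrC.
Qed.

Lemma dotv_grad_ref_coord (R : realType) (A : 'M[R]_2) (b x m : 'cV[R]_2)
    (l : 'I_2) :
  dotv m (grad (fun y => ref_coord A b y l 0) x) = (invmx A *m m) l 0.
Proof.
rewrite dotvE mxE; apply: eq_bigr => i _; rewrite mxE mulrC; congr (_ * _).
have [_ ->] := is_derive_line (f := fun y => ref_coord A b y l 0)
  (fun h => ref_coord_line A b x (delta_mx i 0) h l).
rewrite derivD derivC derivZ derivX !hornerE -colE mxE //.
Qed.

(** * Lagrange interpolation and the tensor-product basis *)

Lemma size_lagrange_poly (R : realType) (n : nat) (z : 'I_n -> R) (i : 'I_n) :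
  (size (lagrange_poly z i) <= n)%N.
Proof.
apply: leq_trans (size_poly_prod_leq _ _) _.
have n0 : (0 < n)%N by case: n i {z} => [[]|].
have -> : #|(fun j : 'I_n => j != i)| = n.-1 by rewrite cardC1 card_ord.
have : (\sum_(j < n | j != i)
    size ((z i - z j)^-1 *: ('X - (z j)%:P))  <= 2 * n.-1)%N.
  rewrite mulnC -[in X in (_ <= X * _)%N](card_ord n) -(cardC1 i) -sum_nat_const.
  apply: leq_sum => j _; apply: leq_trans (size_scale_leq _ _) _.
  by rewrite size_XsubC.
case: n n0 i z => // n _ i z /= le_sum.
by rewrite leq_subLR addnS ltnS addnn -mul2n.
Qed.

Lemma lagrange_polyE (R : realType) (n : nat) (z : 'I_n -> R) (i j : 'I_n) :
  injective z -> (lagrange_poly z i).[z j] = (i == j)%:R.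
Proof.
move=> zI; rewrite horner_prod; case: eqVneq => [<-|ij].
  by apply: big1 => k ki; rewrite !hornerE mulVf // subr_eq0 (inj_eq zI) eq_sym.
by rewrite (bigD1 j) 1?eq_sym //= !hornerE subrr mulr0 mul0r.
Qed.

(** The difference of both sides has the [n] nodes as roots, and a size of at
    most [n]. *)
Lemma lagrange_interpolation (R : realType) (n : nat) (z : 'I_n -> R)
    (q : {poly R}) :
  injective z -> (size q <= n)%N ->
  \sum_i q.[z i] *: lagrange_poly z i = q.
Proof.
move=> zI sq; apply/eqP; rewrite -subr_eq0; apply/eqP.
apply: (@roots_geq_poly_eq0 _ _ (codom z)).
- apply/allP => _ /codomP[j ->]; rewrite rootE hornerD hornerN horner_sum.
  rewrite (bigD1 j) //= big1 => [|i ij]; last first.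
    by rewrite hornerZ lagrange_polyE // (negPf ij) mulr0.
  by rewrite hornerZ lagrange_polyE // eqxx mulr1 addr0 subrr.
- by rewrite map_inj_uniq ?enum_uniq.
rewrite size_codom card_ord; apply: leq_trans (size_polyD _ _) _.
rewrite geq_max size_polyN sq andbT; apply: leq_trans (size_sum _ _ _) _.
apply/bigmax_leqP => i _; apply: leq_trans (size_scale_leq _ _) _.
exact: size_lagrange_poly.
Qed.

(** On a line, the reference coordinates are affine in the parameter, so a basis
    function is a polynomial in it. *)
Lemma derivable_nodal_basis (R : realType) (p : nat) (z : 'I_p.+1 -> R)
    (A : 'M[R]_2) (b x v : 'cV[R]_2) (k : 'I_(p.+1 * p.+1)) :
  derivable (fun y => nodal_basis z A b y k 0) x v.
Proof.
case/mxvec_indexP: k => i j.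
pose line (l : 'I_2) : {poly R} :=
  (ref_coord A b x l 0)%:P + (invmx A *m v) l 0 *: 'X.
have line_phi h : nodal_basis z A b (h *: v + x) (mxvec_index i j) 0 =
    ((lagrange_poly z i \Po line 0) * (lagrange_poly z j \Po line 1)).[h].
  by rewrite /nodal_basis mxE mxvecE mxE hornerM !horner_comp !ref_coord_line.
by have [] := is_derive_line
  (f := fun y => nodal_basis z A b y (mxvec_index i j) 0) line_phi.
Qed.

(** The coefficients are the nodal values: the double sum is the product of
    the two one-dimensional interpolants. *)
Lemma nodal_basis_interpolation (R : realType) (p : nat) (z : 'I_p.+1 -> R)
    (A : 'M[R]_2) (b : 'cV[R]_2) (f g : {poly R}) :
  injective z -> (size f <= p.+1)%N -> (size g <= p.+1)%N ->
  exists c, forall x, dotv (nodal_basis z A b x) c =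
    f.[ref_coord A b x 0 0] * g.[ref_coord A b x 1 0].
Proof.
move=> zI sf sg.
exists (mxvec (\matrix_(i < p.+1, j < p.+1) (f.[z i] * g.[z j])))^T => x.
rewrite dotvE (reindex _ (curry_mxvec_bij _ _)) /=.
rewrite -[in RHS](lagrange_interpolation zI sf).
rewrite -[in RHS](lagrange_interpolation zI sg) !horner_sum mulr_suml.
under [in RHS]eq_bigr => i _ do rewrite mulr_sumr.
rewrite pair_bigA; apply: eq_bigr => -[i j] _ /=.
by rewrite /nodal_basis !mxE !mxvecE !mxE !hornerZ mulrC mulrACA.
Qed.

(** The case of [X * 1] and [1 * X]; size 2 is where [0 < p] matters. *)
Lemma ref_coord_comb (R : realType) (p : nat) (z : 'I_p.+1 -> R)
    (A : 'M[R]_2) (b : 'cV[R]_2) (l : 'I_2) :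
  (0 < p)%N -> injective z ->
  exists c, forall x, dotv (nodal_basis z A b x) c = ref_coord A b x l 0.
Proof.
move=> p0 zI; have s1 : (size (1%R : {poly R}) <= p.+1)%N by rewrite size_poly1.
have sX : (size ('X : {poly R}) <= p.+1)%N by rewrite size_polyX.
have [->|->] : l = 0 \/ l = 1.
  by case: l => [[|[|//]] ?]; [left|right]; apply: val_inj.
- have [c cE] := nodal_basis_interpolation A b zI sX s1.
  by exists c => x; rewrite cE hornerX hornerC mulr1.
- have [c cE] := nodal_basis_interpolation A b zI s1 sX.
  by exists c => x; rewrite cE hornerX hornerC mul1r.
Qed.

(** The reference coordinates are in the span of the basis and their derivatives
    along [m] form the vector [A^-1 m]: if all basis functions were flat along
    [m] at [x], this vector would vanish. *)
Lemma dir_grad_nodal_neq0 (R : realType) (p : nat) (z : 'I_p.+1 -> R)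
    (A : 'M[R]_2) (b m x : 'cV[R]_2) :
  (0 < p)%N -> injective z -> A \in unitmx -> m != 0 ->
  dir_grad (nodal_basis z A b) m x != 0.
Proof.
move=> p0 zI uA; apply: contraNneq => dm0.
suff Am0 : invmx A *m m = 0 by rewrite -(mulKVmx uA m) Am0 mulmx0.
apply/colP => l; rewrite [RHS]mxE -(dotv_grad_ref_coord A b x).
have [c /funext <-] := ref_coord_comb A b l p0 zI.
rewrite dir_grad_comb => [|k i]; last exact: derivable_nodal_basis.
by rewrite dm0 dotvE big1 // => k _; rewrite mxE mul0r.
Qed.

(** * The modified Neumann condition *)

Theorem proposition5 (R : realType) (p : nat) (hp : (1 <= p)%N)
  (z : 'I_p.+1 -> R) (hz : gll_nodes z)
  (A : 'M[R]_2) (hA : A \in unitmx) (b : 'cV[R]_2)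
  (mesh domain : set 'cV[R]_2) (hmesh : element A b `<=` mesh)
  (bmap : 'cV[R]_2 -> 'cV[R]_2)
  (hbmap : forall x, frontier mesh x -> frontier domain (bmap x))
  (xt nt : 'cV[R]_2) (hxtE : element A b xt) (hxt : frontier mesh xt)
  (hnt : unit_normal (frontier mesh) xt nt)
  (xb n : 'cV[R]_2) (hxb : xb = bmap xt)
  (hn : unit_normal (frontier domain) xb n)
  (u : 'cV[R]_(p.+1 * p.+1)) (qN : R) :
  let phi := nodal_basis z A b in
  let w := dir_grad phi n xb in
  saddle_mx w \in unitmx /\
  forall (v : 'cV[R]_(p.+1 * p.+1)) (lam : R),
    saddle_mx w *m col_mx v lam%:M = col_mx u qN%:M ->
    let uN := fun x : 'cV[R]_2 => dotv (phi x) v in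
    let qt := dotv nt (grad uN xt) in
    let alpha := dotv (dir_grad phi nt xt) w / norm2 w ^+ 2 in
    qt = dotv (dir_grad phi nt xt - alpha *: w) u + alpha * qN.
Proof.
move=> phi w.
have zI : injective z.
  have [z_incr _] := hz; move=> i j zij; apply/val_inj.
  by case: (ltngtP i j) => // /z_incr; rewrite zij ltxx.
have n0 : n != 0.
  apply: contra_eq_neq hn.1 => ->.
  rewrite /norm2 big1 ?sqrtr0 1?eq_sym ?oner_eq0 //.
  by move=> i _; rewrite mxE expr0n.
have w0 : w != 0 by exact: dir_grad_nodal_neq0.
split=> [|v lam system uN qt alpha]; first exact: saddle_mx_unit.
rewrite -(dotv_saddle_solution _ w0 system).
by apply: dir_grad_comb => k l; exact: derivable_nodal_basis.
Qed.
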